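(* Let $d\ge 1$ be an integer. Let $\mu_1,\mu_2,\mu_3\in\mathbb{R}^d$ be arbitrary, and let $w_1,w_2,w_3\ge 0$ be arbitrary real weights satisfying $w_1+w_2+w_3=1$. Let $\varphi$ be the standard $d$-variate Gaussian density and let $$\overline{\varphi}(x)=\sum_{j=1}^{3} w_j\,\varphi(x-\mu_j),\qquad x\in\mathbb{R}^d.$$ Then $\overline{\varphi}$ has at most $15$ critical points. In particular, every critical point of $\overline{\varphi}$ is isolated. (No non-degeneracy assumption on the critical points is imposed.)
   Context: The standard $d$-variate Gaussian density is $\varphi(x)=(2\pi)^{-d/2}\exp(-\|x\|_2^2/2)$ for $x\in\mathbb{R}^d$. A critical point of $\overline{\varphi}$ is a point $x\in\mathbb{R}^d$ at which the gradient of $\overline{\varphi}$ vanishes. A critical point is isolated if it has a neighborhood containing no other critical point. Critical points are counted as distinct points, without multiplicity. *)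

(* Defs.v *)
From mathcomp Require Import all_boot all_order all_algebra.
From mathcomp Require Import all_classical all_reals all_analysis.
Set Implicit Arguments.
Unset Strict Implicit.
Unset Printing Implicit Defensive.
Import Order.TTheory GRing.Theory Num.Theory.
Import numFieldNormedType.Exports.
Local Open Scope classical_set_scope.
Local Open Scope ring_scope.

(* The library norm `|x| on 'rV[R]_d is the sup norm, hence this definition. *)
Definition enorm (R : realType) (d : nat) (x : 'rV[R]_d) : R :=
  Num.sqrt (\sum_(i < d) x 0 i ^+ 2).

Definition std_gaussian (R : realType) (d : nat) (x : 'rV[R]_d) : R :=
  (2 * pi) `^ (- (d%:R / 2)) * expR (- (enorm x ^+ 2 / 2)).

Definition gaussian_mixture (R : realType) (d k : nat)
    (w : 'I_k -> R) (mu : 'I_k -> 'rV[R]_d) (x : 'rV[R]_d) : R :=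
  \sum_(j < k) w j * std_gaussian (x - mu j).

(* Meaningful where the partial derivatives of f exist; it is only used for
   Gaussian mixtures, which are smooth. *)
Definition gradient (R : realType) (d : nat) (f : 'rV[R]_d -> R)
    (x : 'rV[R]_d) : 'rV[R]_d :=
  \row_(i < d) 'D_(delta_mx 0 i) f x.

Definition critical_points (R : realType) (d : nat) (f : 'rV[R]_d -> R) :
    set 'rV[R]_d :=
  [set x | gradient f x = 0].

(* Main.v *)
Require Import Defs.
From mathcomp Require Import all_boot all_order all_algebra.
From mathcomp Require Import all_classical all_reals all_analysis.
From mathcomp Require Import ring lra.
Set Implicit Arguments.
Unset Strict Implicit.
Unset Printing Implicit Defensive.
Import Order.TTheory GRing.Theory Num.Theory.
Import numFieldNormedType.Exports.
Local Open Scope classical_set_scope.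
Local Open Scope card_scope.
Local Open Scope ring_scope.

(** At a critical point x every component pulls with strength
    q_j = w_j exp (- |x - mu_j|^2 / 2), so x is the barycenter of the means
    with weights p_j = q_j / (q_1 + q_2 + q_3). Whatever the dimension, the
    problem thus lives on the open triangle of the (p_1, p_2, p_3): there, x is
    critical iff ln (p_1 / p_3) and ln (p_2 / p_3) are two affine functions of p
    whose coefficients are the inner products of e = mu1 - mu3 and
    f = mu2 - mu3.

    The first equation can be solved. Put v = <x - mu2, e> and s = p_1 + p_3.
    Then p_1 / p_3 = r e^v for a constant r, and the equation reads
    v = s * slope v with slope v = <e, e> p_1 / (p_1 + p_3) - <e, f>.
    Its solutions form the graph s = v / slope v over the open set where this
    quotient lies in ]0, 1[, together with the whole segment v = 0 in case
    slope 0 = 0.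

    On the graph the second equation says that a function residual of v is
    constant, and the derivative of residual is, up to a factor without zeros,
    an exponential polynomial jac v = P_0 + P_1 e^v + P_2 e^(2v) + P_3 e^(3v)
    whose coefficients P_i in v have 3, 4, 4 and 3 terms. By Rolle's theorem an
    exponential polynomial with 14 terms has at most 13 zeros
    ([expoly_zeros]). The graph has at most two pieces
    ([admissible_one_gap]), so a last application of Rolle's theorem leaves at
    most 13 + 2 = 15 solutions ([residual_zeros], [curve_solutions]).

    If slope 0 = 0, the points of the segment v = 0 come in addition. They are
    zeros of ln s - ln (1 - s) minus an affine function, hence at most 3
    ([logit_line]). In exchange jac has a triple zero at v = 0, outside the
    graph, so that only 10 of its zeros matter ([jac_zeros_pinned]), and the
    total is again at most (10 + 2) + 3 = 15.

    Rolle's theorem is only used to count distinct zeros, which is why no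
    non-degeneracy of the critical points enters. A vanishing weight leaves two
    components, whose critical points are counted by [logit_line], or one. If
    mu1 = mu3, relabelling restores <e, e> > 0 unless all means coincide, in
    which case there is one critical point. Finally, in a Hausdorff space the
    points of a finite set are isolated. *)

(** * Sets with a bounded number of elements *)

(** Counting by duplicate-free lists rather than by [#<=] lets each bound be
    proved by manipulating the sorted list of the points. *)
Definition at_most (T : eqType) (n : nat) (S : set T) : Prop :=
  forall s : seq T, uniq s -> {in s, forall x, S x} -> (size s <= n)%N.

Lemma at_most_inj (T U : eqType) (n : nat) (S : set T) (S' : set U)
    (f : T -> U) :
  (forall x, S x -> S' (f x)) ->
  (forall x y, S x -> S y -> f x = f y -> x = y) ->
  at_most n S' -> at_most n S.
Proof.
move=> fS finj hS' s us sS; rewrite -(size_map f); apply: hS'.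
  by rewrite map_inj_in_uniq// => x y xs ys; apply: finj; apply: sS.
by move=> _ /mapP[x xs ->]; apply/fS/sS.
Qed.

Lemma at_most_sub (T : eqType) (n : nat) (S S' : set T) :
  S `<=` S' -> at_most n S' -> at_most n S.
Proof. by move=> SS' hS' s us sS; apply: hS' => // x /sS /SS'. Qed.

Lemma at_most_leq (T : eqType) (m n : nat) (S : set T) :
  at_most m S -> (m <= n)%N -> at_most n S.
Proof. by move=> hS mn s us sS; rewrite (leq_trans _ mn)//; apply: hS. Qed.

Lemma at_mostU (T : eqType) (m n : nat) (A B : set T) :
  at_most m A -> at_most n B -> at_most (m + n) (A `|` B).
Proof.
move=> hA hB s us sS; rewrite -(count_predC (fun x => `[< A x >])) -!size_filter.
apply: leq_add.
  by apply: hA; rewrite ?filter_uniq// => x; rewrite mem_filter => /andP[/asboolP].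
apply: hB; rewrite ?filter_uniq// => x; rewrite mem_filter /= => /andP[/asboolP nA].
by move=> /sS[].
Qed.

Lemma at_most_card (T : choiceType) (n : nat) (S : set T) :
  at_most n S -> S #<= `I_n.
Proof.
move=> hS; have [Sfin|/(@infinite_set_fset _ _ n.+1)[B BS nB]] := pselect (finite_set S).
  have [m Sm] := Sfin.
  rewrite (card_le_eql Sm) card_le_II -(card_fset_set Sm).
  by apply: hS; rewrite ?finmap.fset_uniq// => x; rewrite in_fset_set// inE.
suff : (n.+1 <= n)%N by rewrite ltnn.
rewrite (leq_trans nB)//; apply: hS; first exact: finmap.fset_uniq.
by move=> x xB; apply: BS.
Qed.

(** * Counting zeros by Rolle's theorem *)

Section RolleCounting.
Context {R : realType}.
Implicit Types (f df : R -> R) (Z : R -> Prop).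

Lemma is_derive_cont f df (x y : R) :
  (forall z, x <= z <= y -> is_derive z 1 f (df z)) ->
  {within `[x, y], continuous f}.
Proof.
move=> hf; apply: derivable_within_continuous => z; rewrite in_itv/= => /hf[].
by [].
Qed.

Lemma mean_value f df (x y : R) : x < y ->
  (forall z, x <= z <= y -> is_derive z 1 f (df z)) ->
  exists2 z, x < z < y & f y - f x = df z * (y - x).
Proof.
move=> xy hf; have hc := is_derive_cont hf.
have [|z] := @MVT R f df x y xy _ hc.
  by move=> z; rewrite in_itv/= => /andP[xz zy]; apply: hf; rewrite !ltW.
by rewrite in_itv/= => zxy E; exists z.
Qed.

Lemma rolle_between f df (x y : R) : x < y ->
  (forall z, x <= z <= y -> is_derive z 1 f (df z)) -> f x = f y ->
  exists2 z, x < z < y & df z = 0.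
Proof.
move=> xy hf fxy; have [z zxy] := mean_value xy hf.
rewrite fxy subrr => /esym/eqP; rewrite mulf_eq0 subr_eq0 (gt_eqF xy) orbF.
by move=> /eqP; exists z.
Qed.

Fixpoint gaps (good : rel R) (x : R) (s : seq R) : nat :=
  if s is y :: s' then (~~ good x y + gaps good y s')%N else 0%N.

(** All uses of Rolle's theorem go through this combinatorial core: [Z] has a
    point between two consecutive points of the list unless these are separated
    by a gap. That the new points avoid the old ones is what allows a prescribed
    zero to be kept apart in [at_most_rolle_pinned]. *)
Lemma interlace (good : rel R) Z (x : R) (s : seq R) :
  path <%R x s ->
  {in x :: s &, forall y z, y < z -> good y z -> exists2 c, y < c < z & Z c} ->
  exists zs : seq R, [/\ path <%R x zs, {in zs, forall c, Z c},
    {in zs, forall c, c \notin x :: s} & (size s <= size zs + gaps good x s)%N].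
Proof.
elim: s x => [|y s IH] x /=; first by exists [::].
move=> /andP[xy ys] hZ.
have [u v us vs|zs [yzs zsZ zsN szs]] := IH y ys.
  by apply: hZ; rewrite inE ?us ?vs orbT.
have ygt : {in zs, forall c, y < c}.
  by move=> c; apply/allP; move: yzs; rewrite lt_path_sortedE => /andP[].
have sgt : {in s, forall c, y < c}.
  by move=> c; apply/allP; move: ys; rewrite lt_path_sortedE => /andP[].
have zsN' : {in zs, forall c, c \notin [:: x, y & s]}.
  by move=> c czs; rewrite inE negb_or (gt_eqF (lt_trans xy (ygt c czs))) zsN.
have [gxy|ngxy] := boolP (good x y); last first.
  exists zs; split => //=; last by rewrite addnCA add1n ltnS.
  by case: zs ygt yzs {szs zsN zsZ zsN'} => //= c zs /(_ c (mem_head _ _)) yc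
    /andP[_ ->]; rewrite (lt_trans xy).
have [||c /andP[xc cy] Zc] := hZ x y _ _ xy gxy; rewrite ?mem_head//.
  by rewrite !inE eqxx orbT.
exists (c :: zs); split => //=.
- rewrite xc /=; case: zs ygt yzs {szs zsN zsZ zsN'} => //= e zs.
  by move=> /(_ e (mem_head _ _)) ye /andP[_ ->]; rewrite (lt_trans cy).
- by move=> e; rewrite inE => /orP[/eqP->//|/zsZ].
- move=> e; rewrite inE => /orP[/eqP->|/zsN'//].
  rewrite !inE !negb_or (gt_eqF xc) (lt_eqF cy) /=.
  by apply/negP => /sgt; rewrite ltNge (ltW cy).
Qed.

Lemma gaps0 (x : R) (s : seq R) : gaps (fun _ _ => true) x s = 0%N.
Proof. by elim: s x => //= y s IH x; rewrite IH. Qed.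

Lemma sorted_rep (s : seq R) : uniq s -> exists t : seq R,
  [/\ sorted <%R t, s =i t & size s = size t].
Proof.
move=> us; exists (sort <=%R s); rewrite sort_lt_sorted; split => //.
  by move=> x; rewrite mem_sort.
by rewrite size_sort.
Qed.

Lemma at_most_rolle f df (n : nat) :
  (forall x : R, is_derive x 1 f (df x)) ->
  at_most n [set x | df x = 0] -> at_most n.+1 [set x | f x = 0].
Proof.
move=> hf hdf s0 /sorted_rep[[|x s] [xs ms ->]] s0Z //=.
rewrite ltnS; have fxs : {in x :: s, forall y, f y = 0}.
  by move=> y; rewrite -ms => /s0Z.
have [y z yi zi yz _|zs [pzs zsZ _ szs]] :=
  @interlace (fun _ _ => true) (fun c => df c = 0) x s xs.
  by apply: (rolle_between yz (fun c _ => hf c)); rewrite !fxs.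
move: szs; rewrite gaps0 addn0 => /leq_trans; apply; apply: hdf => //.
by apply: (sorted_uniq lt_trans ltxx); apply: path_sorted pzs.
Qed.

(** Adding the known zero [k] to the list of the others compensates the zero
    that Rolle's theorem loses. Each use consumes one order of vanishing
    at [k]. *)
Lemma at_most_rolle_pinned f df (n : nat) (k : R) :
  (forall x : R, is_derive x 1 f (df x)) -> f k = 0 ->
  at_most n [set x | df x = 0 /\ x != k] -> at_most n [set x | f x = 0 /\ x != k].
Proof.
move=> hf fk hdf s0 us0 s0Z.
have : uniq (k :: s0).
  by rewrite /= us0 andbT; apply/negP => /s0Z[_]; rewrite eqxx.
move=> /sorted_rep[[|x s] [xs ms ss]] //.
have -> : size s0 = size s by case: ss.
have fxs : {in x :: s, forall y, f y = 0}.
  by move=> y; rewrite -ms inE => /orP[/eqP->//|/s0Z[]].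
have [y z yi zi yz _|zs [pzs zsZ zsN szs]] :=
  @interlace (fun _ _ => true) (fun c => df c = 0) x s xs.
  by apply: (rolle_between yz (fun c _ => hf c)); rewrite !fxs.
move: szs; rewrite gaps0 addn0 => /leq_trans; apply; apply: hdf => //.
  by apply: (sorted_uniq lt_trans ltxx); apply: path_sorted pzs.
move=> y yzs; split; first exact: zsZ.
by apply: contraNneq (zsN _ yzs) => ->; rewrite -ms mem_head.
Qed.

Lemma gaps_ge1 (good : rel R) (x : R) (s : seq R) : path <%R x s ->
  (0 < gaps good x s)%N ->
  exists y z, [/\ y \in x :: s, z \in x :: s, y < z & ~~ good y z].
Proof.
elim: s x => //= y s IH x /andP[xy ys].
have [_|gxy _] := boolP (good x y); last first.
  by exists x, y; split => //; rewrite !inE eqxx ?orbT.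
rewrite add0n => /(IH _ ys)[u [v [us vs uv nuv]]].
by exists u, v; split => //; rewrite inE ?us ?vs orbT.
Qed.

Lemma gaps_ge2 (good : rel R) (x : R) (s : seq R) : path <%R x s ->
  (1 < gaps good x s)%N ->
  exists y z y' z', [/\ y \in x :: s, z \in x :: s, y' \in x :: s & z' \in x :: s] /\
     [/\ y < z, z <= y', y' < z', ~~ good y z & ~~ good y' z'].
Proof.
elim: s x => //= y s IH x /andP[xy ys].
have [_|gxy] := boolP (good x y).
  rewrite add0n => /(IH _ ys)[u [v [u' [v' [[us vs us' vs'] h]]]]].
  by exists u, v, u', v'; split => //; split; rewrite inE ?us ?vs ?us' ?vs' orbT.
rewrite add1n ltnS => /(gaps_ge1 ys)[u [v [us vs uv nuv]]].
exists x, y, u, v; split; first by split; rewrite inE ?eqxx ?us ?vs ?orbT// inE eqxx orbT.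
split => //; move: us; rewrite inE => /orP[/eqP->//|us].
by move: ys; rewrite lt_path_sortedE => /andP[/allP/(_ _ us)/ltW].
Qed.

(** The hypothesis on [w1 < v1 < w2 < v2 < w3] says that [U] has at most two
    pieces. Rolle's theorem loses one zero at the end of the list and one more
    at the passage from one piece to the other. *)
Lemma at_most_rolle_gap (h dh : R -> R) (U : set R) (n : nat) :
  (forall x : R, U x -> is_derive x 1 h (dh x)) ->
  (forall w1 v1 w2 v2 w3, U w1 -> w1 < v1 < w2 -> ~ U v1 -> U w2 ->
     w2 < v2 < w3 -> ~ U v2 -> U w3 -> False) ->
  at_most n [set x | dh x = 0 /\ U x] ->
  at_most n.+2 [set x | h x = 0 /\ U x].
Proof.
move=> hh no2 hdh s0 /sorted_rep[[|x s] [xs ms ->]] s0Z //=.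
have hxs : {in x :: s, forall y, h y = 0}.
  by move=> y; rewrite -ms => /s0Z[].
have Uxs : {in x :: s, forall y, U y}.
  by move=> y; rewrite -ms => /s0Z[].
pose good y z := `[< forall c, y <= c <= z -> U c >].
have [y z yi zi yz /asboolP gyz|zs [pzs zsZ _ szs]] :=
  @interlace good (fun c => dh c = 0 /\ U c) x s xs.
  have [|c /andP[yc cz] dc] := rolle_between yz (fun c cc => hh c (gyz c cc)).
    by rewrite !hxs.
  by exists c; rewrite ?yc//; split => //; apply: gyz; rewrite !ltW.
rewrite ltnS (leq_trans szs)// -addn1 leq_add//.
  by apply: hdh => //; apply: (sorted_uniq lt_trans ltxx); apply: path_sorted pzs.
rewrite leqNgt; apply/negP => /(gaps_ge2 xs)[y [z [y' [z' [[yi zi y'i z'i]]]]]].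
have bad u v : u \in x :: s -> v \in x :: s -> ~~ good u v ->
    exists2 c, u < c < v & ~ U c.
  move=> ui vi /asboolPn/existsNP[c /not_implyP[/andP[uc cv] nU]].
  exists c => //; rewrite !lt_neqAle uc cv !andbT; apply/andP; split.
    by apply/eqP => E; apply: nU; rewrite -E; apply: Uxs.
  by apply/eqP => E; apply: nU; rewrite E; apply: Uxs.
move=> [yz zy' yz' /(bad _ _ yi zi)[c /andP[yc cz] nc]].
move=> /(bad _ _ y'i z'i)[c' /andP[yc' cz'] nc'].
apply: (no2 y c z c' z') => //; try exact: Uxs; first by rewrite yc cz.
by rewrite (le_lt_trans zy') ?cz'.
Qed.

End RolleCounting.

(** * Real exponential polynomials *)

Section ExponentialPolynomials.
Context {R : realType}.
Implicit Types (ps : seq {poly R}) (p : {poly R}).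

(** The sum of the P_i(u) e^(i u), in Horner form: peeling off the head
    coefficient divides by e^u, as the zero count requires. *)
Fixpoint expoly ps (u : R) : R :=
  if ps is p :: qs then p.[u] + expR u * expoly qs u else 0.

(** The shift [j] makes the recursion structural: this is the list of
    coefficients of e^(- j u) (e^(j u) E(u))', where E has coefficients [ps]. *)
Fixpoint expoly_deriv (j : nat) ps : seq {poly R} :=
  if ps is p :: qs then (p^`() + p *+ j) :: expoly_deriv j.+1 qs else [::].

Definition weight ps : nat := \sum_(p <- ps) size p.

Lemma expoly_cons p ps u : expoly (p :: ps) u = p.[u] + expR u * expoly ps u.
Proof. by []. Qed.

Lemma expoly_derivS j ps u :
  expoly (expoly_deriv j.+1 ps) u = expoly (expoly_deriv j ps) u + expoly ps u.
Proof.
elim: ps j => [|p ps IH] j /=; first by rewrite addr0.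
by rewrite IH mulrSr !hornerD; ring.
Qed.

Lemma is_derive_expoly ps (u : R) :
  is_derive u 1 (expoly ps) (expoly (expoly_deriv 0 ps) u).
Proof.
elim: ps => [|p ps IH]; first exact: is_derive_cst.
have h := is_deriveD (is_derive_poly p u) (is_deriveM (is_derive_expR u) IH).
apply: (@is_derive_eq _ _ _ _ _ _ _ _ h).
rewrite /= expoly_derivS mulr0n addr0 /GRing.scale /=; ring.
Qed.

Lemma weight_deriv_le j ps : (weight (expoly_deriv j ps) <= weight ps)%N.
Proof.
elim: ps j => [|p ps IH] j; rewrite /weight /= ?big_nil ?big_cons//.
rewrite leq_add ?IH// (leq_trans (size_polyD _ _))// geq_max -scaler_nat.
rewrite size_scale_leq andbT.
by have [->|/lt_size_deriv/ltnW//] := eqVneq p 0; rewrite deriv0.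
Qed.

(** In characteristic zero the operator P |-> P' + j P preserves the degree for
    [0 < j], so differentiating an exponential polynomial shortens only P_0. *)
Lemma size_derivMn p j : (0 < j)%N -> size (p^`() + p *+ j) = size p.
Proof.
move=> j0; have [->|p0] := eqVneq p 0; first by rewrite deriv0 mul0rn addr0.
have sj : size (p *+ j) = size p.
  by rewrite -scaler_nat size_scale// pnatr_eq0 -lt0n.
by rewrite addrC size_polyDl sj// lt_size_deriv.
Qed.

Lemma has_expoly_deriv j ps : (0 < j)%N ->
  has (predC1 0) ps -> has (predC1 0) (expoly_deriv j ps).
Proof.
elim: ps j => //= p ps IH j j0 /orP[p0|/(IH j.+1 (ltn0Sn _))->]; last by rewrite orbT.
by rewrite -size_poly_eq0 size_derivMn// size_poly_eq0 p0.
Qed.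

Lemma weight_gt0 ps : has (predC1 0) ps -> (0 < weight ps)%N.
Proof.
elim: ps => //= p ps IH; rewrite /weight big_cons addn_gt0 size_poly_gt0.
by move=> /orP[->//|/IH->]; rewrite orbT.
Qed.

Lemma expoly0 ps u : ~~ has (predC1 0) ps -> expoly ps u = 0.
Proof.
elim: ps => //= p ps IH; rewrite negb_or negbK => /andP[/eqP-> /IH h].
by rewrite h horner0; ring.
Qed.

Lemma deriv_eq0 p : p^`() = 0 -> p = (p`_0)%:P.
Proof.
move=> /polyP dp0; apply/polyP => -[|i]; rewrite coefC//=.
have /eqP := dp0 i; rewrite coef_deriv coef0 -mulr_natr mulf_eq0 pnatr_eq0 orbF.
by move=> /eqP.
Qed.

(** The bound is the one of ordinary polynomials, the number of coefficients
    minus one, and the proof is Rolle's induction: differentiation removes a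
    coefficient of P_0, and once P_0 is exhausted a factor e^u can be removed
    without changing the zeros. *)
Lemma expoly_zeros ps : has (predC1 0) ps ->
  at_most (weight ps).-1 [set u : R | expoly ps u = 0].
Proof.
have [n] := ubnP (weight ps + size ps)%N; elim: n ps => // n IH [|p ps]//=.
have [->|p0] := eqVneq p 0.
  rewrite ltnS /weight big_cons size_poly0 add0n addnS => ltn /= hps.
  apply: at_most_sub (IH ps ltn hps) => u /=.
  by rewrite horner0 add0r => /eqP; rewrite mulf_eq0 expR_eq0/= => /eqP.
set ps' := expoly_deriv 0 (p :: ps) => ltn _.
have wlt : (weight ps' < weight (p :: ps))%N.
  rewrite /ps' /= /weight !big_cons mulr0n addr0 -addSn leq_add//.
    exact: lt_size_deriv.
  exact: weight_deriv_le.
have szps' : size ps' = size (p :: ps).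
  by rewrite /ps' /=; congr _.+1; elim: (ps) 1%N => //= q qs IHq j; rewrite IHq.
have [hq|hq] := boolP (has (predC1 0) ps').
  have /IH/(_ hq)/(at_most_rolle (is_derive_expoly (p :: ps))) :
      (weight ps' + size ps' < n)%N.
    by rewrite szps' (leq_trans _ (ltn : (_ <= n)%N))// ltn_add2r.
  move=> /at_most_leq; apply; rewrite prednK ?weight_gt0//.
  by rewrite -ltnS prednK// (leq_trans _ wlt).
move: hq; rewrite /ps' /= mulr0n addr0 negb_or negbK => /andP[/eqP/deriv_eq0 pE].
move=> /(contra (has_expoly_deriv (ltn0Sn 0))) /expoly0 q0 [//|u s _].
move=> /(_ u (mem_head _ _))/=; rewrite q0 pE hornerC mulr0 addr0 => E.
by move: p0; rewrite pE E eqxx.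
Qed.

End ExponentialPolynomials.

(** * Pointwise forms of the rules of differentiation *)

Section Calculus.
Context {R : realType}.
Implicit Types (f g : R -> R) (x : R).

Lemma is_derive1V f x df : f x != 0 -> is_derive x 1 f df ->
  is_derive x 1 (fun y => (f y)^-1) (- df / f x ^+ 2).
Proof.
move=> fx0 [fd <-]; split; first exact: derivableV.
by rewrite deriveV// /GRing.scale/= mulrC mulrN -mulNr.
Qed.

Lemma is_derive1_cst (c x : R) : is_derive x 1 (fun=> c) 0.
Proof. exact: is_derive_cst. Qed.

Lemma is_derive1_id x : is_derive x 1 (fun y => y) 1.
Proof. exact: is_derive_id. Qed.

Lemma is_derive1D f g x df dg : is_derive x 1 f df -> is_derive x 1 g dg ->
  is_derive x 1 (fun y => f y + g y) (df + dg).
Proof. exact: is_deriveD. Qed.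

Lemma is_derive1B f g x df dg : is_derive x 1 f df -> is_derive x 1 g dg ->
  is_derive x 1 (fun y => f y - g y) (df - dg).
Proof. exact: is_deriveB. Qed.

Lemma is_derive1M f g x df dg : is_derive x 1 f df -> is_derive x 1 g dg ->
  is_derive x 1 (fun y => f y * g y) (f x * dg + g x * df).
Proof. exact: is_deriveM. Qed.

Lemma is_derive1_lnf f x df : 0 < f x -> is_derive x 1 f df ->
  is_derive x 1 (fun y => ln (f y)) ((f x)^-1 * df).
Proof. by move=> f0 hf; apply: is_derive1_comp; apply: is_derive1_ln. Qed.

End Calculus.

(** * The logit curve meets a line in at most three points *)

Section LogitLine.
Context {R : realType}.

(** In the coordinate u = ln s - ln (1 - s) one has s = e^u / (1 + e^u), and the
    equation becomes the vanishing of the exponential polynomial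
    (u - be) + (u - be - al) e^u, which has four coefficients. *)
Lemma logit_line (al be : R) :
  at_most 3 [set s : R | 0 < s < 1 /\ ln s - ln (1 - s) = al * s + be].
Proof.
have hpos (s : R) : 0 < s < 1 -> expR (ln s - ln (1 - s)) = s / (1 - s).
  by move=> /andP[s0 s1]; rewrite expRD expRN !lnK// posrE subr_gt0.
pose ps : seq {poly R} := [:: Poly [:: - be; 1]; Poly [:: - be - al; 1]].
have hps : has (predC1 0) ps.
  apply/orP; left; apply/eqP => /polyP/(_ 1%N).
  by rewrite coef_Poly coef0/=; exact/eqP/oner_neq0.
have wps : ((weight ps).-1 <= 3)%N.
  rewrite -subn1 leq_subLR /weight !big_cons big_nil addn0.
  by apply: (@leq_add _ _ 2 2); apply: size_Poly.
apply: (at_most_inj (f := fun s => ln s - ln (1 - s)) _ _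
  (at_most_leq (expoly_zeros hps) wps)).
- move=> s [s01 E]; change (expoly ps (ln s - ln (1 - s)) = 0).
  rewrite /ps !expoly_cons !horner_Poly /= hpos// E.
  by case/andP: s01 => s0 s1; field; lra.
- move=> s s' /= [s01 _] [s01' _] E.
  have := hpos s s01; rewrite E hpos// => /eqP.
  case/andP: s01 => s0 s1; case/andP: s01' => s0' s1'.
  by rewrite eqr_div ?subr_eq0 ?(gt_eqF s1) ?(gt_eqF s1')// => /eqP; lra.
Qed.

End LogitLine.

(** * The curve of the first critical equation *)

Section Curve.
Context {R : realType}.
Variables (r b B a : R).
Hypotheses (r_gt0 : 0 < r) (b_gt0 : 0 < b).

(** For a critical point x, with v = <x - mu2, e>, [odds v] is p_1 / p_3 and
    [share v] is p_1 / (p_1 + p_3); [b] is <e, e> and [B] is <e, f>. *)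
Definition odds (v : R) : R := r * expR v.
Definition share (v : R) : R := odds v / (1 + odds v).
Definition slope (v : R) : R := b * share v - B.
(** Equivalent to 0 < v / slope v < 1, but free of the poles of the
    quotient. *)
Definition admissible : set R := [set v | 0 < v * (slope v - v)].

Lemma odds_gt0 v : 0 < odds v. Proof. by rewrite mulr_gt0// expR_gt0. Qed.

Lemma is_derive_odds (v : R) : is_derive v 1 odds (odds v).
Proof.
apply: (is_derive_eq (is_derive1M (is_derive1_cst r v) (is_derive_expR v))).
by rewrite /odds/=; ring.
Qed.

Lemma is_derive_share (v : R) : is_derive v 1 share (odds v / (1 + odds v) ^+ 2).
Proof.
have T0 := odds_gt0 v.
have d1T := is_derive1D (is_derive1_cst 1 v) (is_derive_odds v).
apply: (is_derive_eq (is_derive1M (is_derive_odds v) (is_derive1V _ d1T))).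
  by rewrite gt_eqF// addr_gt0.
by rewrite /=; field; lra.
Qed.

Lemma is_derive_slope (v : R) : is_derive v 1 slope (b * (odds v / (1 + odds v) ^+ 2)).
Proof.
apply: (is_derive_eq (is_derive1B (is_derive1M (is_derive1_cst b v) (is_derive_share v))
  (is_derive1_cst B v))).
by rewrite /=; ring.
Qed.

(** The derivative of slope v - v has the sign of b T - (1 + T)^2 with
    T = odds v. This quadratic is concave in T, so the set where it is positive
    is an interval: the function cannot increase, decrease, and increase
    again. *)
Lemma no_up_down_up (x1 y1 x2 y2 x3 y3 : R) (psi := fun v => slope v - v) :
  x1 < y1 -> y1 <= x2 -> x2 < y2 -> y2 <= x3 -> x3 < y3 ->
  psi x1 < psi y1 -> psi y2 < psi x2 -> psi x3 < psi y3 -> False.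
Proof.
move=> xy1 yx2 xy2 yx3 xy3 p1 p2 p3.
have dpsi (v : R) : is_derive v 1 psi (b * (odds v / (1 + odds v) ^+ 2) - 1).
  exact: (is_derive1B (is_derive_slope v) (is_derive1_id v)).
have [c1 /andP[xc1 cy1] E1] := mean_value xy1 (fun v _ => dpsi v).
have [c2 /andP[xc2 cy2] E2] := mean_value xy2 (fun v _ => dpsi v).
have [c3 /andP[xc3 cy3] E3] := mean_value xy3 (fun v _ => dpsi v).
have h1 : 0 < b * (odds c1 / (1 + odds c1) ^+ 2) - 1.
  by rewrite -(pmulr_lgt0 _ (_ : 0 < y1 - x1)) ?subr_gt0// -E1 subr_gt0.
have h2 : b * (odds c2 / (1 + odds c2) ^+ 2) - 1 < 0.
  by rewrite -(pmulr_llt0 _ (_ : 0 < y2 - x2)) ?subr_gt0// -E2 subr_lt0.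
have h3 : 0 < b * (odds c3 / (1 + odds c3) ^+ 2) - 1.
  by rewrite -(pmulr_lgt0 _ (_ : 0 < y3 - x3)) ?subr_gt0// -E3 subr_gt0.
have T12 : odds c1 < odds c2 by rewrite ltr_pM2l// ltr_expR; lra.
have T23 : odds c2 < odds c3 by rewrite ltr_pM2l// ltr_expR; lra.
have T1 := odds_gt0 c1; have T2 := odds_gt0 c2; have T3 := odds_gt0 c3.
have q1 : (1 + odds c1) ^+ 2 < b * odds c1.
  by move: h1; rewrite subr_gt0 mulrA ltr_pdivlMr ?mul1r// exprn_gt0//; lra.
have q2 : b * odds c2 < (1 + odds c2) ^+ 2.
  by move: h2; rewrite subr_lt0 mulrA ltr_pdivrMr ?mul1r// exprn_gt0//; lra.
have q3 : (1 + odds c3) ^+ 2 < b * odds c3.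
  by move: h3; rewrite subr_gt0 mulrA ltr_pdivlMr ?mul1r// exprn_gt0//; lra.
move: q1 q2 q3 T12 T23 T1.
move: (odds c1) (odds c2) (odds c3) => t1 t2 t3 q1 q2 q3 t12 t23 t0.
(* The four positive quantities below sum to zero: this is the identity
   defining the second divided difference of (1 + t)^2 - b t, which is 1. *)
have e1 : 0 < (t3 - t2) * (b * t1 - (1 + t1) ^+ 2) by rewrite mulr_gt0 ?subr_gt0.
have e3 : 0 < (t2 - t1) * (b * t3 - (1 + t3) ^+ 2) by rewrite mulr_gt0 ?subr_gt0.
have e2 : 0 < (t3 - t1) * ((1 + t2) ^+ 2 - b * t2).
  by rewrite mulr_gt0 ?subr_gt0// (lt_trans t12).
have e4 : 0 < (t2 - t1) * (t3 - t2) * (t3 - t1).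
  by rewrite !mulr_gt0 ?subr_gt0// (lt_trans t12).
have := addr_gt0 (addr_gt0 e1 e3) (addr_gt0 e2 e4).
by rewrite [X in 0 < X](_ : _ = 0) ?ltxx//; ring.
Qed.

(** The points w_i are admissible and the v_i are not, which fixes the signs of
    slope v - v at all five points in terms of their position with respect to 0.
    The signs alternate except across 0, and wherever 0 lies this leaves enough
    alternations for the pattern excluded by [no_up_down_up]. *)
Lemma admissible_one_gap (w1 v1 w2 v2 w3 : R) :
  admissible w1 -> w1 < v1 < w2 -> ~ admissible v1 ->
  admissible w2 -> w2 < v2 < w3 -> ~ admissible v2 -> admissible w3 ->
  False.
Proof.
rewrite /admissible/= => U1 /andP[wv1 vw1] /negP + U2 /andP[wv2 vw2] /negP + U3.
rewrite -!leNgt => V1 V2.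
have Upos w : 0 < w * (slope w - w) -> 0 < w -> 0 < slope w - w.
  by move=> + w0; rewrite pmulr_rgt0.
have Uneg w : 0 < w * (slope w - w) -> w < 0 -> slope w - w < 0.
  by move=> + w0; rewrite nmulr_rgt0.
have Vpos w : w * (slope w - w) <= 0 -> 0 < w -> slope w - w <= 0.
  by move=> + w0; rewrite pmulr_rle0.
have Vneg w : w * (slope w - w) <= 0 -> w < 0 -> 0 <= slope w - w.
  by move=> + w0; rewrite nmulr_rle0.
have nz w : 0 < w * (slope w - w) -> w < 0 \/ 0 < w.
  by move=> + ; case: (ltgtP w 0) => [||->]; [left|right|rewrite mul0r ltxx].
have [v1pos|v1neg] := ltP 0 v1.
  have v2pos : 0 < v2 by lra.
  have := Upos _ U2; have := Upos _ U3; have := Vpos _ V1; have := Vpos _ V2.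
  move=> ????; apply: (@no_up_down_up v1 w2 w2 v2 v2 w3); lra.
have w1neg : w1 < 0 by lra.
have P1 := Uneg _ U1 w1neg.
have [v2pos|v2neg] := ltP 0 v2.
  have P3 := Upos _ U3 (lt_trans v2pos vw2); have Q2 := Vpos _ V2 v2pos.
  have [w2neg|w2pos] := nz _ U2.
    have := Uneg _ U2 w2neg; have := Vneg _ V1 (lt_trans vw1 w2neg).
    by move=> ??; apply: (@no_up_down_up w1 v1 v1 w2 w2 w3); lra.
  have := Upos _ U2 w2pos.
  by move=> ?; apply: (@no_up_down_up w1 w2 w2 v2 v2 w3); lra.
have w2neg : w2 < 0 by lra.
have P2 := Uneg _ U2 w2neg; have Q1 := Vneg _ V1 (lt_trans vw1 w2neg).
have [w3neg|w3pos] := nz _ U3.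
  have := Vneg _ V2 (lt_trans vw2 w3neg).
  by move=> ?; apply: (@no_up_down_up w1 v1 v1 w2 w2 v2); lra.
have := Upos _ U3 w3pos.
by move=> ?; apply: (@no_up_down_up w1 v1 v1 w2 w2 w3); lra.
Qed.


(** * The second critical equation along the curve *)

Definition mass (v : R) : R := v / slope v.

(** Along the curve this is ln (p_2 / p_3) minus <x - mu3, f>, where [a] stands
    for <f, f>. *)
Definition residual (v : R) : R :=
  ln (1 - mass v) - ln (mass v) + ln (1 + odds v)
  - (mass v * (share v * B) + (1 - mass v) * a).

(** The Jacobian determinant of the two critical equations in (p_1, p_2), times
    p_1 p_2 p_3, is a cubic polynomial in p. This is its value on the curve,
    multiplied by the cube of n = (1 + t) slope v to clear denominators. *)
Definition jac (v : R) : R :=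
  let t := odds v in let n := (b - B) * t - B in
  n ^+ 3 - b * n * t * v ^+ 2
  - v * (n - v * (1 + t)) * n * ((a + b - 2 * B) * t + a)
  + (a * b - B ^+ 2) * v ^+ 2 * t * (n - v * (1 + t)).

Definition jac_coefs : seq {poly R} :=
  let g := b - B in let c := a + b - 2 * B in let D := a * b - B ^+ 2 in
  [:: Poly [:: - B ^+ 3; - (a * B ^+ 2); - (a * B)];
      Poly [:: r * (3 * g * B ^+ 2); r * (2 * g * B * a - c * B ^+ 2);
               r * (b * B + a * (g - B) - c * B - D * B); r * - D];
      Poly [:: r ^+ 2 * (- 3 * g ^+ 2 * B); r ^+ 2 * (2 * g * B * c - a * g ^+ 2);
               r ^+ 2 * (- (b * g) + a * g + c * (g - B) + D * g); r ^+ 2 * - D];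
      Poly [:: r ^+ 3 * g ^+ 3; r ^+ 3 * (- c * g ^+ 2); r ^+ 3 * (c * g)]].

Lemma expoly_jac v : expoly jac_coefs v = jac v.
Proof.
rewrite /jac_coefs; cbv zeta; rewrite !expoly_cons !horner_Poly /= /jac /odds.
ring.
Qed.

Lemma weight_jac : (weight jac_coefs <= 14)%N.
Proof.
rewrite /weight !big_cons big_nil addn0.
by apply: (@leq_add _ _ 3 11); [|apply: (@leq_add _ _ 4 7); [|apply: (@leq_add _ _ 4 3)]];
  apply: size_Poly.
Qed.

Lemma slope_neq0 v : admissible v -> slope v != 0.
Proof.
rewrite /admissible/=; case: eqP => // ->.
by rewrite sub0r mulrN oppr_gt0 ltNge -expr2 sqr_ge0.
Qed.

Lemma mass_itv v : admissible v -> 0 < mass v < 1.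
Proof.
move=> Uv; have m0 := slope_neq0 Uv; move: Uv; rewrite /admissible/= => Uv.
have m2 : 0 < slope v ^+ 2 by rewrite exprn_even_gt0.
have s01 : 0 < mass v * (1 - mass v).
  rewrite (_ : _ * _ = v * (slope v - v) / slope v ^+ 2) ?divr_gt0//.
  by rewrite /mass; field.
nra.
Qed.

Definition dresidual (v : R) : R :=
  let t := odds v in let s := mass v in
  let ds := (slope v - v * (b * (t / (1 + t) ^+ 2))) / slope v ^+ 2 in
  - ds / (1 - s) - ds / s + t / (1 + t)
  - ds * (share v * B) - s * (t / (1 + t) ^+ 2 * B) + ds * a.

Lemma is_derive_residual v : admissible v -> is_derive v 1 residual (dresidual v).
Proof.
move=> Uv; have m0 := slope_neq0 Uv; have /andP[s0 s1] := mass_itv Uv.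
have T0 := odds_gt0 v.
have dm : is_derive v 1 mass
    ((slope v - v * (b * (odds v / (1 + odds v) ^+ 2))) / slope v ^+ 2).
  apply: (is_derive_eq (is_derive1M (is_derive1_id v)
    (is_derive1V m0 (is_derive_slope v)))).
  by rewrite /=; field; rewrite m0 gt_eqF ?addr_gt0.
have d1m := is_derive1B (is_derive1_cst 1 v) dm.
have d1T := is_derive1D (is_derive1_cst 1 v) (is_derive_odds v).
have dB := is_derive1M (is_derive_share v) (is_derive1_cst B v).
have s1' : 0 < 1 - mass v by rewrite subr_gt0.
have T1 : 0 < 1 + odds v by rewrite addr_gt0.
have h1 := is_derive1B (is_derive1_lnf (f := fun y => 1 - mass y) s1' d1m)
  (is_derive1_lnf s0 dm).
have h2 := is_derive1D h1 (is_derive1_lnf (f := fun y => 1 + odds y) T1 d1T).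
have h3 := is_derive1D (is_derive1M dm dB) (is_derive1M d1m (is_derive1_cst a v)).
apply: (is_derive_eq (is_derive1B h2 h3)).
rewrite /dresidual /=; move: (mass v) s0 s1' => s s0 s1'.
by field; rewrite m0 !gt_eqF.
Qed.

(** Along the curve of the first equation, the second equation has a critical
    point exactly where the two differentials are dependent, that is, where
    the Jacobian determinant vanishes. *)
Lemma jac_dresidual v : admissible v ->
  jac v = - ((1 + odds v) ^+ 3 * slope v ^+ 2 * (v * (slope v - v))) * dresidual v.
Proof.
move=> Uv; have m0 := slope_neq0 Uv; have T0 := odds_gt0 v.
have v0 : v != 0.
  by move: Uv; rewrite /admissible/=; case: eqP => // ->; rewrite mul0r ltxx.
have mv0 : slope v - v != 0.
  by move: Uv; rewrite /admissible/=; case: eqP => // ->; rewrite mulr0 ltxx.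
rewrite /jac /dresidual /mass.
have -> : share v = odds v / (1 + odds v) by [].
have T1 : 1 + odds v != 0 by rewrite gt_eqF// addr_gt0.
have : B = b * (odds v / (1 + odds v)) - slope v.
  by rewrite /slope /share; ring.
move: (slope v) m0 mv0 (odds v) T1 => m m0 mv0 t T1 ->.
by field; rewrite m0 v0 mv0 T1.
Qed.


Lemma jac_coefs_neq0 : has (predC1 0) jac_coefs.
Proof.
apply/negP => /negP/hasPn P0.
have P00 i : (i < 4)%N -> (jac_coefs`_i)`_0 = 0.
  move=> i4; have ilt : (i < size jac_coefs)%N by exact: i4.
  by have /negPn/eqP-> := P0 _ (mem_nth 0 ilt); rewrite coef0.
have /eqP := P00 0%N isT.
rewrite /jac_coefs/= coef_cons/= oppr_eq0 expf_eq0/= => /eqP B0.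
have /eqP := P00 3%N isT; rewrite /jac_coefs/= coef_cons/=.
by rewrite B0 subr0 mulf_eq0 !expf_eq0/= (gt_eqF r_gt0) (gt_eqF b_gt0).
Qed.

Lemma jac_zeros : at_most 13 [set v : R | jac v = 0].
Proof.
have wj : ((weight jac_coefs).-1 <= 13)%N by rewrite -subn1 leq_subLR weight_jac.
apply: at_most_sub (at_most_leq (expoly_zeros jac_coefs_neq0) wj) => v /=.
by rewrite -expoly_jac.
Qed.

(** Here v and (b - B) odds v - B both vanish at 0, and jac is homogeneous of
    degree 3 in these two quantities up to smooth coefficients: 0 is a triple
    zero. Three pinned steps use up the three coefficients of P_0, and the
    coefficients of the third derivative number 4 + 4 + 3 = 11. *)
Lemma jac_zeros_pinned : slope 0 = 0 -> at_most 10 [set v : R | jac v = 0 /\ v != 0].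
Proof.
move=> m0.
have gr : (b - B) * r = B.
  have : slope 0 * (1 + r) = (b - B) * r - B.
    by rewrite /slope /share /odds expR0; field; rewrite gt_eqF ?addr_gt0.
  by rewrite m0 mul0r => /esym/eqP; rewrite subr_eq0 => /eqP.
have g0 : b - B != 0.
  apply/eqP => g0; move: gr; rewrite g0 mul0r => E.
  by move: b_gt0; rewrite (_ : b = 0) ?ltxx//; lra.
pose D := @expoly_deriv R 0.
have r1 : 1 + r != 0 by rewrite gt_eqF ?addr_gt0.
have BE : B = b * r / (1 + r).
  by rewrite -[LHS](mulfK r1); congr (_ / _); move: gr; rewrite mulrBl; lra.
have E0 : expoly jac_coefs 0 = 0.
  by rewrite expoly_jac /jac /odds expR0 BE; field; exact: r1.
have E1 : expoly (D jac_coefs) 0 = 0.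
  rewrite /D /jac_coefs /= !horner_coef0 !(coefD, coefMn, coef_deriv) !coef_cons.
  by rewrite /= expR0 BE; field; exact: r1.
have E2 : expoly (D (D jac_coefs)) 0 = 0.
  rewrite /D /jac_coefs /= !horner_coef0 !(coefD, coefMn, coef_deriv) !coef_cons.
  by rewrite /= expR0 BE; field; exact: r1.
have nz3 : has (predC1 0) (D (D (D jac_coefs))).
  have nzq : has (predC1 0) (behead jac_coefs).
    apply/orP; right; apply/orP; right; apply/orP; left; apply/eqP => /polyP/(_ 0%N)/eqP.
    by rewrite coef_cons coef0 mulf_eq0 !expf_eq0/= (gt_eqF r_gt0) (negPf g0).
  have keep := @has_expoly_deriv R 1 _ (ltn0Sn 0).
  by apply/orP; right; exact: keep (keep _ (keep _ nzq)).
have size_D (p : {poly R}) n : (size p <= n.+1)%N -> (size (p^`() + p *+ 0)%R <= n)%N.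
  rewrite mulr0n addr0; have [->|/lt_size_deriv lp] := eqVneq p 0.
    by rewrite deriv0 size_poly0.
  by move=> sp; rewrite -ltnS (leq_trans lp).
have w3 : ((weight (D (D (D jac_coefs)))).-1 <= 10)%N.
  rewrite -subn1 leq_subLR /weight big_cons -[(1 + 10)%N]/(0 + 11)%N leq_add//.
    by do 3 apply: (size_D); apply: size_Poly.
  have le ps := @weight_deriv_le R 1 ps.
  apply: (leq_trans (le _) (leq_trans (le _) (leq_trans (le (behead jac_coefs)) _))).
  rewrite /weight !big_cons big_nil addn0.
  by apply: (@leq_add _ _ 4 7); [|apply: (@leq_add _ _ 4 3)]; apply: size_Poly.
have step ps : expoly ps 0 = 0 ->
    at_most 10 [set u | expoly (D ps) u = 0 /\ u != 0] ->
    at_most 10 [set u | expoly ps u = 0 /\ u != 0].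
  exact: at_most_rolle_pinned (is_derive_expoly ps).
have := at_most_leq (expoly_zeros nz3) w3.
move=> /(at_most_sub (S := [set u | expoly _ u = 0 /\ u != 0]) (fun _ => @proj1 _ _)).
move=> /(step _ E2)/(step _ E1)/(step _ E0).
by apply: at_most_sub => v [jv v0]; split; rewrite ?expoly_jac.
Qed.

Lemma residual_zeros C n : at_most n [set v | jac v = 0 /\ admissible v] ->
  at_most n.+2 [set v | residual v = C /\ admissible v].
Proof.
move=> hn.
have dC (v : R) : admissible v -> is_derive v 1 (fun v => residual v - C) (dresidual v).
  move=> Uv; rewrite -[dresidual v]subr0.
  exact: (is_derive1B (is_derive_residual Uv) (is_derive1_cst C v)).
have := at_most_rolle_gap (n := n) dC admissible_one_gap.
have hn' : at_most n [set v | dresidual v = 0 /\ admissible v].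
  apply: at_most_sub hn => v [E Uv]; split => //.
  by rewrite jac_dresidual// E mulr0.
move=> /(_ hn'); apply: at_most_sub => v [E Uv]; split => //=.
by rewrite E subrr.
Qed.

(** A solution with v <> 0 lies on the graph s = v / slope v and is a zero of
    residual - C; a solution with v = 0 exists only if slope 0 = 0, and is then
    an intersection of the logit curve with a line. *)
Lemma curve_solutions C : at_most 15 [set vs : R * R |
  [/\ 0 < vs.2 < 1, vs.1 = vs.2 * slope vs.1 &
  ln (1 - vs.2) - ln vs.2 + ln (1 + odds vs.1) =
  C + (vs.2 * (share vs.1 * B) + (1 - vs.2) * a)]].
Proof.
set S := [set vs | _].
have adm vs : S vs -> vs.1 != 0 -> admissible vs.1 /\ vs.2 = mass vs.1.
  case: vs => v s [/= /andP[s0 s1] vE _] v0.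
  have m0 : slope v != 0 by apply: contraNneq v0 => m0; rewrite vE m0 mulr0.
  split; last by rewrite /mass {1}vE mulfK.
  rewrite /admissible/= (_ : _ * _ = s * (1 - s) * slope v ^+ 2).
    by apply: mulr_gt0; [rewrite mulr_gt0 ?subr_gt0|rewrite exprn_even_gt0].
  by rewrite {1 3}vE; ring.
have off n : at_most n [set v | residual v = C /\ admissible v] ->
    at_most n (S `&` [set vs | vs.1 != 0]).
  apply: (at_most_inj (f := fst)).
    move=> vs [Svs v0]; have [Uv sE] := adm _ Svs v0; split => //.
    by case: Svs => _ _ E; rewrite /residual -sE E addrK.
  move=> [v s] [v' s'] [Svs v0] [Svs' v0'] /= E.
  have [_ /= ->] := adm _ Svs v0; have [_ /= ->] := adm _ Svs' v0'.
  by rewrite E.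
have [m0|m0] := eqVneq (slope 0) 0; last first.
  apply: at_most_sub (off _ (residual_zeros (n := 13) _)); last first.
    by apply: at_most_sub jac_zeros => v [].
  move=> vs Svs; split => //=; apply: contraNneq m0 => v0.
  case: Svs => /andP[s0 _] + _; rewrite v0 => /esym/eqP.
  by rewrite mulf_eq0 (gt_eqF s0).
have h12 : at_most 12 (S `&` [set vs | vs.1 != 0]).
  apply: off; apply: residual_zeros; apply: at_most_sub (jac_zeros_pinned m0) => v [E Uv].
  by split => //; move: Uv; rewrite /admissible/=; case: eqP => // ->; rewrite mul0r ltxx.
have h3 : at_most 3 (S `&` [set vs | vs.1 = 0]).
  apply: (at_most_inj (f := snd) _ _
     (@logit_line R (a - share 0 * B) (ln (1 + odds 0) - C - a))).
    by move=> [v s] [[/= s01 _ E] v0]; split => //; move: E; rewrite v0; lra.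
  by move=> [v s] [v' s'] [_ /= ->] [_ /= ->] ->.
apply: at_most_sub (at_mostU h12 h3) => vs Svs.
by have [v0|v0] := eqVneq vs.1 0; [right|left].
Qed.

End Curve.

(** * Critical points of Gaussian mixtures *)

Section DotProduct.
Context {R : realType} {d : nat}.
Implicit Types x y z : 'rV[R]_d.

Definition dot x y : R := \sum_(i < d) x 0 i * y 0 i.

Lemma dotC x y : dot x y = dot y x.
Proof. by apply: eq_bigr => i _; rewrite mulrC. Qed.

Lemma dotDl x y z : dot (x + y) z = dot x z + dot y z.
Proof. by rewrite -big_split; apply: eq_bigr => i _; rewrite mxE mulrDl. Qed.

Lemma dotZl c x z : dot (c *: x) z = c * dot x z.
Proof. by rewrite mulr_sumr; apply: eq_bigr => i _; rewrite mxE mulrA. Qed.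

Lemma dotBl x y z : dot (x - y) z = dot x z - dot y z.
Proof. by rewrite -scaleN1r dotDl dotZl mulN1r. Qed.

Lemma dotDr x y z : dot z (x + y) = dot z x + dot z y.
Proof. by rewrite !(dotC z) dotDl. Qed.

Lemma dotZr c x z : dot z (c *: x) = c * dot z x.
Proof. by rewrite !(dotC z) dotZl. Qed.

Lemma dotBr x y z : dot z (x - y) = dot z x - dot z y.
Proof. by rewrite !(dotC z) dotBl. Qed.

Lemma enorm_sqr x : enorm x ^+ 2 = dot x x.
Proof.
rewrite sqr_sqrtr; last by apply: sumr_ge0 => i _; rewrite sqr_ge0.
by apply: eq_bigr => i _; rewrite expr2.
Qed.

Lemma dot_gt0 x : x != 0 -> 0 < dot x x.
Proof.
move=> x0; rewrite lt_neqAle sumr_ge0 ?andbT => [|i _]; last by rewrite -expr2 sqr_ge0.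
apply: contraNneq x0 => /esym dot0; apply/eqP/rowP => i.
have /eqP : x 0 i * x 0 i = 0.
  have nneg (j : 'I_d) : true -> 0 <= x 0 j * x 0 j by rewrite -expr2 sqr_ge0.
  exact: (psumr_eq0P nneg dot0).
by rewrite mulf_eq0 orbb mxE => /eqP.
Qed.

Lemma dot_delta i x : dot (delta_mx 0 i) x = x 0 i.
Proof.
rewrite /dot (bigD1 i)//= big1 ?mxE ?eqxx ?mul1r ?addr0// => j ji.
by rewrite mxE (negPf ji) mul0r.
Qed.

End DotProduct.

Section CriticalEquation.
Context {R : realType} {d : nat}.
Implicit Types x y v mu : 'rV[R]_d.

(** The mass of one component without the normalizing constant of the Gaussian
    density, which does not affect critical points. *)
Definition bump (w : R) mu x : R := w * expR (- (dot (x - mu) (x - mu) / 2)).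

(** Reduces directional derivatives to functions of one real variable. *)
Lemma derive_line (f : 'rV[R]_d -> R) v x :
  'D_v f x = 'D_1 (fun t : R => f (t *: v + x)) 0.
Proof.
apply: (congr1 (fun g : R -> R => lim (g @ 0^'))); apply/funext => h /=.
by rewrite addr0 scale0r add0r [h *: 1]mulr1.
Qed.

Lemma derive_mixture k (w : 'I_k -> R) (mu : 'I_k -> 'rV[R]_d) v x :
  'D_v (gaussian_mixture w mu) x =
  - ((2 * pi) `^ (- (d%:R / 2)) * \sum_(j < k) bump (w j) (mu j) x * dot v (x - mu j)).
Proof.
rewrite derive_line; set c := _ `^ _.
pose term j (t : R) := c * (w j *
  expR (- (dot (x - mu j) (x - mu j) + (2 * dot v (x - mu j)) * t
           + dot v v * t ^+ 2) / 2)).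
have -> : (fun t : R => gaussian_mixture w mu (t *: v + x)) = \sum_(j < k) term j.
  apply/funext => t; rewrite fct_sumE; apply: eq_bigr => j _.
  rewrite /std_gaussian enorm_sqr mulrCA /term; congr (_ * (_ * expR _)).
  rewrite -addrA; move: (x - mu j) => y.
  by rewrite dotDl !dotDr !dotZr !dotZl (dotC y v); field.
have dterm j : is_derive (0 : R) 1 (term j)
    (- c * (bump (w j) (mu j) x * dot v (x - mu j))).
  pose q (t : R) : R := (dot (x - mu j) (x - mu j)
    + (2 * dot v (x - mu j)) * t + dot v v * (t * t)) / 2.
  have id0 := is_derive1_id (0 : R).
  have dq : is_derive (0 : R) 1 q (dot v (x - mu j)).
    have h := is_derive1D (is_derive1D (is_derive1_cst (dot (x - mu j) (x - mu j)) 0)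
      (is_derive1M (is_derive1_cst (2 * dot v (x - mu j)) 0) id0))
      (is_derive1M (is_derive1_cst (dot v v) 0) (is_derive1M id0 id0)).
    apply: (is_derive_eq (is_derive1M h (is_derive1_cst (2^-1) 0))).
    by rewrite /=; field.
  have dN := is_derive1B (is_derive1_cst 0 0) dq.
  have dE := is_derive1_comp (f := expR) (is_derive_expR _) dN.
  have dwE := is_derive1M (is_derive1_cst c 0) (is_derive1M (is_derive1_cst (w j) 0) dE).
  have -> : term j = fun t => c * (w j * expR (0 - q t)).
    by apply/funext => t; rewrite /term /q sub0r expr2 mulNr.
  apply: (is_derive_eq dwE).
  have q0 : q 0 = dot (x - mu j) (x - mu j) / 2 by rewrite /q !mulr0 !addr0.
  by rewrite /= /bump q0 sub0r; ring.
have -> := @derive_val _ _ _ _ _ _ _ (is_derive_sum dterm).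
by rewrite -mulr_sumr mulNr.
Qed.

Lemma critical_points_mixture k (w : 'I_k -> R) (mu : 'I_k -> 'rV[R]_d) :
  critical_points (gaussian_mixture w mu) =
  [set x | \sum_(j < k) bump (w j) (mu j) x *: (x - mu j) = 0].
Proof.
have c0 : 0 < (2 * pi) `^ (- (d%:R / 2)) :> R.
  by rewrite powR_gt0// mulr_gt0 ?pi_gt0.
have E x i : (gradient (gaussian_mixture w mu) x) 0 i =
    - ((2 * pi) `^ (- (d%:R / 2)) *
      (\sum_(j < k) bump (w j) (mu j) x *: (x - mu j)) 0 i).
  rewrite mxE derive_mixture summxE; congr (- (_ * _)); apply: eq_bigr => j _.
  by rewrite dot_delta !mxE.
apply/seteqP; split => x /= /rowP hx; apply/rowP => i; have := hx i.
  rewrite E [X in _ = X]mxE => /eqP; rewrite oppr_eq0 mulf_eq0 (gt_eqF c0)/= => /eqP ->.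
  by rewrite mxE.
by rewrite E => ->; rewrite !mxE mulr0 oppr0.
Qed.

End CriticalEquation.

(** * Mixtures of three components *)

Section ThreeBumps.
Context {R : realType} {d : nat}.
Implicit Types x mu : 'rV[R]_d.

Definition balanced3 (w1 w2 w3 : R) (mu1 mu2 mu3 : 'rV[R]_d) : set 'rV[R]_d :=
  [set x | bump w1 mu1 x *: (x - mu1) + bump w2 mu2 x *: (x - mu2)
         + bump w3 mu3 x *: (x - mu3) = 0].

Lemma balanced3_swap12 (w1 w2 w3 : R) mu1 mu2 mu3 :
  balanced3 w1 w2 w3 mu1 mu2 mu3 = balanced3 w2 w1 w3 mu2 mu1 mu3.
Proof. by rewrite /balanced3; apply/seteqP; split => x /=; rewrite [X in X + _]addrC. Qed.

Lemma balanced3_swap23 (w1 w2 w3 : R) mu1 mu2 mu3 :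
  balanced3 w1 w2 w3 mu1 mu2 mu3 = balanced3 w1 w3 w2 mu1 mu3 mu2.
Proof. by rewrite /balanced3; apply/seteqP; split => x /=; rewrite addrAC. Qed.

Lemma bump_gt0 (w : R) mu x : 0 < w -> 0 < bump w mu x.
Proof. by move=> w0; rewrite mulr_gt0// expR_gt0. Qed.

Lemma bump_ratio (w w' : R) mu mu' x : 0 < w -> 0 < w' ->
  bump w mu x / bump w' mu' x =
  w / w' * expR (dot (x - mu') (mu - mu') - dot (mu - mu') (mu - mu') / 2).
Proof.
move=> w0 w'0; rewrite /bump.
have -> : expR (- (dot (x - mu) (x - mu) / 2)) =
    expR (dot (x - mu') (mu - mu') - dot (mu - mu') (mu - mu') / 2) *
    expR (- (dot (x - mu') (x - mu') / 2)).
  rewrite -expRD; congr expR.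
  have -> : x - mu = (x - mu') - (mu - mu') by rewrite opprB addrA subrK.
  move: (x - mu') (mu - mu') => y e.
  by rewrite dotBl !dotBr (dotC e y); field.
have := expR_gt0 (- (dot (x - mu') (x - mu') / 2)).
move: (expR (- _)) => E E0.
by field; rewrite !gt_eqF.
Qed.

Lemma balanced3_barycenter (w1 w2 w3 : R) mu1 mu2 mu3 x
    (q1 := bump w1 mu1 x) (q2 := bump w2 mu2 x) (q3 := bump w3 mu3 x) :
  q1 + q2 + q3 != 0 ->
  balanced3 w1 w2 w3 mu1 mu2 mu3 x ->
  x - mu3 = (q1 / (q1 + q2 + q3)) *: (mu1 - mu3)
          + (q2 / (q1 + q2 + q3)) *: (mu2 - mu3).
Proof.
rewrite /balanced3/= -/q1 -/q2 -/q3 => Q0 hx.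
apply: (scalerI Q0); rewrite [RHS]scalerDr !scalerA !(mulrC _ (_ / _)) !divfK//.
move: hx.
have -> : x - mu1 = (x - mu3) - (mu1 - mu3) by rewrite opprB addrA subrK.
have -> : x - mu2 = (x - mu3) - (mu2 - mu3) by rewrite opprB addrA subrK.
move: (x - mu3) (mu1 - mu3) (mu2 - mu3) => y e f /rowP h; apply/rowP => i.
by have := h i; rewrite !mxE; lra.
Qed.

(** The point x is recovered from (v, s) = (<x - mu2, e>, p_1 + p_3), because
    both p_1 and p_2 are functions of (v, s); so critical points inject into the
    solutions counted by [curve_solutions]. *)
Lemma balanced3_generic (w1 w2 w3 : R) mu1 mu2 mu3 :
  0 < w1 -> 0 < w2 -> 0 < w3 -> mu1 != mu3 ->
  at_most 15 (balanced3 w1 w2 w3 mu1 mu2 mu3).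
Proof.
move=> w10 w20 w30 mu13.
pose e := mu1 - mu3; pose f := mu2 - mu3.
have b0 : 0 < dot e e by rewrite dot_gt0// subr_eq0.
pose r := w1 / w3 * expR (dot f e - dot e e / 2).
have r0 : 0 < r by rewrite mulr_gt0 ?expR_gt0 ?divr_gt0.
pose Q x := bump w1 mu1 x + bump w2 mu2 x + bump w3 mu3 x.
have q10 x := bump_gt0 mu1 x w10; have q20 x := bump_gt0 mu2 x w20.
have q30 x := bump_gt0 mu3 x w30.
have Q0 x : 0 < Q x by rewrite !addr_gt0.
pose mass x := (bump w1 mu1 x + bump w3 mu3 x) / Q x.
pose height x := dot (x - mu2) e.
have bary x : balanced3 w1 w2 w3 mu1 mu2 mu3 x ->
    x - mu3 = (bump w1 mu1 x / Q x) *: e + (bump w2 mu2 x / Q x) *: f.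
  by apply: balanced3_barycenter; rewrite gt_eqF//; apply: Q0.
have heightE x : height x = dot (x - mu3) e - dot f e.
  by rewrite -dotBl /f opprB addrA subrK.
have oddsE x : odds r (height x) = bump w1 mu1 x / bump w3 mu3 x.
  rewrite bump_ratio// heightE -/e /odds /r -[LHS]mulrA -expRD.
  by congr (_ * expR _); ring.
have shareE x : share r (height x) = bump w1 mu1 x / (bump w1 mu1 x + bump w3 mu3 x).
  rewrite /share oddsE; move: (q10 x) (q30 x); move: (bump w1 mu1 x) (bump w3 mu3 x).
  by move=> q1 q3 q10' q30'; field; rewrite !gt_eqF ?addr_gt0.
have baryE x : balanced3 w1 w2 w3 mu1 mu2 mu3 x ->
    x - mu3 = (mass x * share r (height x)) *: e + (1 - mass x) *: f.
  move=> /bary ->; congr (_ *: _ + _ *: _).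
    by rewrite shareE /mass; field; rewrite !gt_eqF ?addr_gt0.
  by rewrite /mass /Q; field; rewrite gt_eqF ?Q0.
have mass_itv x : 0 < mass x < 1.
  rewrite /mass divr_gt0 ?addr_gt0//= ltr_pdivrMr// mul1r /Q.
  by rewrite addrAC ltrDl.
apply: (at_most_inj (f := fun x => (height x, mass x)) _ _
  (@curve_solutions R _ _ (dot f e) (dot f f) r0 b0 (ln (w2 / w3) - dot f f / 2))).
  move=> x hx; split => /=; first exact: mass_itv.
  - rewrite [LHS]heightE baryE// dotDl !dotZl /slope; ring.
  - have ratio23 : bump w2 mu2 x / bump w3 mu3 x =
        (1 - mass x) / mass x * (1 + odds r (height x)).
      rewrite oddsE /mass /Q; move: (q10 x) (q20 x) (q30 x).
      move: (bump w1 mu1 x) (bump w2 mu2 x) (bump w3 mu3 x) => q1 q2 q3 p1 p2 p3.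
      by field; rewrite !gt_eqF// !addr_gt0.
    have [m0 m1] : 0 < mass x /\ 0 < 1 - mass x by have /andP[? ?] := mass_itv x; lra.
    have o0 : 0 < 1 + odds r (height x) by rewrite addr_gt0// odds_gt0.
    have -> : ln (1 - mass x) - ln (mass x) + ln (1 + odds r (height x)) =
        ln (bump w2 mu2 x / bump w3 mu3 x).
      have m10 : 0 < (1 - mass x) / mass x by rewrite divr_gt0.
      by rewrite ratio23 [RHS]lnM ?posrE// [in RHS]ln_div ?posrE.
    rewrite bump_ratio//.
    rewrite lnM ?posrE ?expR_gt0 ?divr_gt0// expRK -/f baryE// dotDl !dotZl (dotC e f).
    ring.
move=> x y hx hy [hE mE]; apply: (@addIr _ (- mu3)).
by rewrite baryE// [RHS]baryE// hE mE.
Qed.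

(** The critical points lie on the line through mu1 and mu3, at the fraction s
    of the way where ln (s / (1 - s)) is an affine function of s. *)
Lemma balanced3_two (w1 w3 : R) mu1 mu2 mu3 :
  0 < w1 -> 0 < w3 -> at_most 3 (balanced3 w1 0 w3 mu1 mu2 mu3).
Proof.
move=> w10 w30; pose e := mu1 - mu3.
have q20 x : bump 0 mu2 x = 0 by rewrite /bump mul0r.
have q10 x := bump_gt0 mu1 x w10; have q30 x := bump_gt0 mu3 x w30.
pose mass x := bump w1 mu1 x / (bump w1 mu1 x + bump w3 mu3 x).
have bary x : balanced3 w1 0 w3 mu1 mu2 mu3 x -> x - mu3 = mass x *: e.
  move=> /balanced3_barycenter; rewrite q20 addr0 mul0r scale0r addr0; apply.
  by rewrite gt_eqF// addr_gt0.
apply: (at_most_inj (f := mass) _ _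
  (@logit_line R (dot e e) (ln (w1 / w3) - dot e e / 2))).
  move=> x hx; split.
    by rewrite divr_gt0 ?addr_gt0//= ltr_pdivrMr ?addr_gt0// mul1r ltrDl.
  have -> : ln (mass x) - ln (1 - mass x) = ln (bump w1 mu1 x / bump w3 mu3 x).
    have -> : 1 - mass x = bump w3 mu3 x / (bump w1 mu1 x + bump w3 mu3 x).
      by rewrite /mass; field; rewrite gt_eqF ?addr_gt0.
    by rewrite !ln_div ?posrE ?addr_gt0//; ring.
  rewrite bump_ratio// lnM ?posrE ?expR_gt0 ?divr_gt0// expRK -/e bary// dotZl.
  ring.
move=> x y hx hy E; apply: (@addIr _ (- mu3)).
by rewrite bary// [RHS]bary// E.
Qed.

Lemma balanced3_coincident (w1 w2 w3 : R) mu :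
  0 < w1 + w2 + w3 -> at_most 1 (balanced3 w1 w2 w3 mu mu mu).
Proof.
move=> W0; apply: (@at_most_sub _ _ _ [set mu]); last first.
  move=> [|x [|y s]]//= /andP[+ _] h.
  by rewrite inE negb_or (h x (mem_head _ _)) (h y) ?eqxx// !inE eqxx orbT.
move=> x; rewrite /balanced3/= -!scalerDl => /eqP.
rewrite !scaler_eq0 subr_eq0 (gt_eqF (expR_gt0 _)) (gt_eqF W0).
by move=> /eqP.
Qed.

Lemma balanced3_single (w3 : R) mu1 mu2 mu3 :
  0 < w3 -> at_most 1 (balanced3 0 0 w3 mu1 mu2 mu3).
Proof.
move=> w30; suff -> : balanced3 0 0 w3 mu1 mu2 mu3 = balanced3 0 0 w3 mu3 mu3 mu3.
  by apply: balanced3_coincident; rewrite !add0r.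
by apply/seteqP; split => x; rewrite /balanced3 /bump /= !mul0r !scale0r.
Qed.

Lemma balanced3_at_most (w1 w2 w3 : R) mu1 mu2 mu3 :
  0 <= w1 -> 0 <= w2 -> 0 <= w3 -> 0 < w1 + w2 + w3 ->
  at_most 15 (balanced3 w1 w2 w3 mu1 mu2 mu3).
Proof.
rewrite 3!le_eqVlt.
move=> /predU1P[<-|w10] /predU1P[<-|w20] /predU1P[<-|w30] W0.
- by move: W0; rewrite !addr0 ltxx.
- by apply: (at_most_leq (balanced3_single w30)).
- by rewrite balanced3_swap23; apply: (at_most_leq (balanced3_single w20)).
- by rewrite balanced3_swap12; apply: (at_most_leq (balanced3_two w20 w30)).
- by rewrite balanced3_swap12 balanced3_swap23;
    apply: (at_most_leq (balanced3_single w10)).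
- by apply: (at_most_leq (balanced3_two w10 w30)).
- by rewrite balanced3_swap23; apply: (at_most_leq (balanced3_two w10 w20)).
have [<-|mu13] := eqVneq mu1 mu3; last exact: balanced3_generic.
have [<-|mu12] := eqVneq mu1 mu2.
  by apply: (at_most_leq (balanced3_coincident W0)).
by rewrite balanced3_swap23; apply: balanced3_generic.
Qed.

End ThreeBumps.

Lemma finite_isolated (T : topologicalType) (A : set T) (x : T) :
  hausdorff_space T -> finite_set A -> x \in A -> isolated A x.
Proof.
move=> hT Afin xA; split => //; exists (~` (A `\` [set x])).
  apply: open_nbhs_nbhs; split; last by move=> [_]; apply.
  have /accessible_finite_set_closed cl := hausdorff_accessible hT.
  by apply: closed_openC; apply: cl; apply: sub_finite_set Afin; apply: subDsetl.
apply/seteqP; split => [y [nAxy Ay]|y ->] /=.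
  by apply: contrapT => yx; apply: nAxy.
by split; [move=> [_]; apply|exact: set_mem].
Qed.

Theorem theorem1 (R : realType) (d : nat) (d_ge1 : (1 <= d)%N)
    (mu : 'I_3 -> 'rV[R]_d) (w : 'I_3 -> R)
    (w_ge0 : forall j, 0 <= w j) (w_sum1 : \sum_(j < 3) w j = 1) :
  critical_points (gaussian_mixture w mu) #<= `I_15 /\
  (forall x, x \in critical_points (gaussian_mixture w mu) ->
     isolated (critical_points (gaussian_mixture w mu)) x).
Proof.
have sum3 (V : nmodType) (F : 'I_3 -> V) :
    \sum_(j < 3) F j = F ord0 + F (lift ord0 ord0) + F ord_max.
  by rewrite !big_ord_recl big_ord0 addr0 addrA; congr (_ + F _); apply: val_inj.
have hcard : critical_points (gaussian_mixture w mu) #<= `I_15.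
  apply: at_most_card; rewrite critical_points_mixture.
  under eq_set do rewrite sum3.
  by apply: balanced3_at_most; rewrite // -sum3 w_sum1.
split=> // x; apply: finite_isolated; first exact: norm_hausdorff.
by apply: card_le_finite hcard _; exact: finite_II.
Qed.
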